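(* Let $I\subseteq\mathbb{R}$ be an interval, let $u:I\to\mathbb{R}$ be differentiable on $I$, let $a,b\in I$ with $a<b$, let $\alpha\in(0,1)$, and set $\rho=\frac{1-\alpha}{\alpha}(b-a)$. If $|u'|$ is convex on $[a,b]$, then $$\left|\frac{u(a)+u(b)}{2}-\frac{1-\alpha}{2\left(1-\exp(-\rho)\right)}\left[\mathcal{I}^\alpha_a u(b)+\mathcal{I}^\alpha_b u(a)\right]\right|\leq \frac{b-a}{2\rho}\tanh\left(\frac{\rho}{4}\right)\left(|u'(a)|+|u'(b)|\right).$$
   Context: For $\alpha\in(0,1)$ and $u\in L_1(a,b)$, the fractional integrals with exponential kernel are defined by $$\mathcal{I}^\alpha_a u(x)=\frac{1}{\alpha}\int_a^x \exp\left(-\frac{1-\alpha}{\alpha}(x-s)\right)u(s)\,ds,\quad x>a,$$ $$\mathcal{I}^\alpha_b u(x)=\frac{1}{\alpha}\int_x^b \exp\left(-\frac{1-\alpha}{\alpha}(s-x)\right)u(s)\,ds,\quad x<b.$$ Thus $\mathcal{I}^\alpha_a u(b)$ is the first operator evaluated at $x=b$, and $\mathcal{I}^\alpha_b u(a)$ is the second evaluated at $x=a$. *)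

(* Defs.v *)
From HB Require Import structures.
From mathcomp Require Import all_boot all_order all_algebra.
From mathcomp Require Import all_classical all_reals all_analysis.

Set Implicit Arguments.
Unset Strict Implicit.
Unset Printing Implicit Defensive.

Import Order.TTheory GRing.Theory Num.Theory.
Import numFieldNormedType.Exports.

Local Open Scope classical_set_scope.
Local Open Scope ring_scope.

(* A function u : I -> R is represented by a total function on R whose values
   outside I are irrelevant.  The library's derivable and derive1 use all
   increments around x, so a derivative relative to I is needed at the
   endpoints belonging to I, where it is the one-sided one; at interior points
   it is the usual two-sided derivative.  The limit is meaningful as soon as x is
   a limit point of I. *)
Definition diff_quotient_filter (R : realType) (I : set R) (u : R -> R) (x : R)
    : set_system R :=
  (fun h : R => h^-1 * (u (x + h) - u x)) @
    within [set h | I (x + h)] (dnbhs (0 : R)).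

Definition derivable_in (R : realType) (I : set R) (u : R -> R) (x : R) : Prop :=
  cvg (diff_quotient_filter I u x).

Definition derive_in (R : realType) (I : set R) (u : R -> R) (x : R) : R :=
  lim (diff_quotient_filter I u x).

Definition frac_int_left (R : realType) (alpha a : R) (u : R -> R) (x : R) : R :=
  alpha^-1 *
  \int[@lebesgue_measure R]_(s in `[a, x])
    (expR (- ((1 - alpha) / alpha) * (x - s)) * u s).

Definition frac_int_right (R : realType) (alpha b : R) (u : R -> R) (x : R) : R :=
  alpha^-1 *
  \int[@lebesgue_measure R]_(s in `[x, b])
    (expR (- ((1 - alpha) / alpha) * (s - x)) * u s).

Definition tanh (R : realType) (x : R) : R :=
  (expR x - expR (- x)) / (expR x + expR (- x)).

(* Main.v *)
Require Import Defs.
From HB Require Import structures.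
From mathcomp Require Import all_boot all_order all_algebra.
From mathcomp Require Import all_classical all_reals all_analysis.
From mathcomp Require Import ring lra.

Import Order.TTheory GRing.Theory Num.Theory.
Import numFieldNormedType.Exports.

Local Open Scope classical_set_scope.
Local Open Scope ring_scope.

(** With [k = (1 - alpha) / alpha], put [S s = e^(-k(b-s)) + e^(-k(s-a))] and
    [D s = e^(-k(b-s)) - e^(-k(s-a))], so that [D' = k S] and [D b = - D a].
    Integration by parts turns [D b (u a + u b) - k \int_a^b S u] into
    [\int_a^b D u'], and convexity bounds [|u'|] by its chord [g].  Since [D] is
    odd about the midpoint [m] of [a, b], only the mean of [g] contributes to
    [\int_a^b |D| g], which gives the constant.  To avoid integrating [u'], the
    function [D u - k \int_a S u], whose derivative is [D u'], is compared on
    [a, m] and on [m, b] with an explicit antiderivative of [D g]. *)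

(** Near [x] the difference quotient is within 1 of its limit [l], so
    [|u y - u x| <= |y - x| (|l| + 1)], endpoints of [I] included. *)
Lemma derivable_in_continuous (R : realType) (I : set R) (u : R -> R) :
  (forall x, I x -> derivable_in I u x) -> {within I, continuous u}.
Proof.
move=> hu; apply/subspace_continuousP => x Ix.
have /cvgrPdist_lt/(_ 1 ltr01)/nbhs_ballP[d /= d0 hd] := hu x Ix.
set l := lim _ in hd.
apply/cvgrPdist_lt => e e0.
have l1 : 0 < `|l| + 1 by rewrite ltr_pwDr.
apply/nbhs_ballP; exists (Num.min d (e / (`|l| + 1))).
  by rewrite /= lt_min d0 divr_gt0.
move=> y /=; rewrite /ball /= lt_min => /andP[xyd xye] Iy.
have [->|yx] := eqVneq y x; first by rewrite subrr normr0.
have yx0 : y - x != 0 by rewrite subr_eq0.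
have /= := hd (y - x); rewrite /ball /= sub0r normrN distrC xyd => /(_ isT yx0).
rewrite addrC subrK => /(_ Iy) lq.
rewrite distrC in xye; rewrite distrC.
have -> : u y - u x = (y - x) * ((y - x)^-1 * (u y - u x)).
  by rewrite mulrA divff // mul1r.
rewrite normrM (le_lt_trans _ (_ : `|y - x| * (`|l| + 1) < e)) //.
  apply: ler_wpM2l => //.
  rewrite -[X in `|X|](subrKC l) (le_trans (ler_normD _ _)) // lerD2l.
  by rewrite distrC ltW.
by rewrite -ltr_pdivlMr.
Qed.

(** When [I] is a neighbourhood of [x], all small increments stay in [I], so the relative limit is
    the two-sided one. *)
Lemma derivable_in_is_derive (R : realType) (I : set R) (u : R -> R) (x : R) :
  nbhs x I -> derivable_in I u x -> is_derive x 1 u (derive_in I u x).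
Proof.
move=> Ix hu.
have cu : (fun h => h^-1 *: (u (h *: 1 + x) - u x)) @ 0^' --> derive_in I u x.
  have I0 : \forall h \near (0 : R), I (x + h) by move/nbhs0P: Ix.
  apply: cvg_trans hu => A /= hA.
  have I0' : \forall h \near (0 : R)^', I (x + h) by apply: cvg_within.
  move: I0' (hA : \forall h \near (0 : R)^', _); apply: filterS2 => h Ih /(_ Ih).
  by rewrite /= -[h%:A]/(h * 1) mulr1 [h + x]addrC.
split; first by apply/cvg_ex; exists (derive_in I u x).
exact: cvg_lim cu.
Qed.

Lemma convex_function_le_chord (R : realType) (f : R -> R) (a b x : R) :
  a < b -> x \in `[a, b] ->
  convex_function (`[a, b]%classic : set R^o) f ->
  f x <= ((b - x) * f a + (x - a) * f b) / (b - a).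
Proof.
move=> ab xab cf.
have t0 : 0 <= (b - x) / (b - a).
  by rewrite divr_ge0 ?subr_ge0 ?(itvP xab) // ltW.
have t1 : (b - x) / (b - a) <= 1.
  by rewrite ler_pdivrMr ?subr_gt0 // mul1r lerD2l lerN2 (itvP xab).
have := cf (Itv01 t0 t1) a b.
rewrite !inE /= !in_itv /= !lexx !(ltW ab) /= => /(_ isT isT).
rewrite convRE /= /unstable.onem.
have ba0 : b - a != 0 by rewrite subr_eq0 gt_eqF.
(* The weight [(b - x) / (b - a)] falls on [a], its complement on [b]. *)
have ->: conv (Itv01 t0 t1) (a : convex_lmodType R^o) b = x.
  by apply: (etrans (convRE _ _ _)) => /=; rewrite /unstable.onem; field.
move=> /le_trans; apply; rewrite le_eqVlt; apply/orP; left; apply/eqP.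
by field.
Qed.

(** Both [g + f] and [g - f] have nonnegative derivative, hence are nondecreasing. This stands in
    for integrating [|df| <= dg], with no integrability of [df]. *)
Lemma ler_dist_derive (R : realType) (f g df dg : R -> R) (a b : R) :
  a <= b ->
  {within `[a, b], continuous f} -> {within `[a, b], continuous g} ->
  (forall x, x \in `]a, b[ -> is_derive x 1 f (df x)) ->
  (forall x, x \in `]a, b[ -> is_derive x 1 g (dg x)) ->
  (forall x, x \in `]a, b[ -> `|df x| <= dg x) ->
  `|f b - f a| <= g b - g a.
Proof.
move=> ab cf cg hf hg fg.
have aab : a \in `[a, b] by rewrite in_itv /= lexx.
have bab : b \in `[a, b] by rewrite in_itv /= lexx ab.
have gDf : g a + f a <= g b + f b.
  have d x : x \in `]a, b[ -> is_derive x 1 (g + f) (dg x + df x).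
    by move=> xab; apply: is_deriveD; [exact: hg|exact: hf].
  apply: (@ger0_derive1_le_cc _ (g + f) a b) => //.
  - by move=> x xab; have [] := d _ xab.
  - move=> x xab; rewrite derive1E; have /@derive_val -> := d _ xab.
    by have := fg _ xab; rewrite ler_norml; lra.
  - exact: within_continuousD.
have gBf : g a - f a <= g b - f b.
  have d x : x \in `]a, b[ -> is_derive x 1 (g - f) (dg x - df x).
    by move=> xab; apply: is_deriveB; [exact: hg|exact: hf].
  apply: (@ger0_derive1_le_cc _ (g - f) a b) => //.
  - by move=> x xab; have [] := d _ xab.
  - move=> x xab; rewrite derive1E; have /@derive_val -> := d _ xab.
    by have := fg _ xab; rewrite ler_norml; lra.
  - exact: within_continuousB.
by rewrite ler_norml; lra.
Qed.

Lemma is_derive_Rintegral (R : realType) (h : R -> R) (a b x : R) :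
  {within `[a, b], continuous h} -> x \in `]a, b[ ->
  is_derive x 1 (fun y => \int[@lebesgue_measure R]_(s in `[a, y]) h s) (h x).
Proof.
move=> ch xab.
have ih : (@lebesgue_measure R).-integrable `[a, b] (EFin \o h).
  by apply: continuous_compact_integrable => //; exact: segment_compact.
have ax : a < x by rewrite (itvP xab).
have xb : x < b by rewrite (itvP xab).
have chx := within_continuous_continuous (lt_trans ax xb) ch xab.
have [d e] := continuous_FTC1_closed xb ih ax chx.
by split; [exact: d|rewrite -derive1E; exact: e].
Qed.

(** With [q = e^(-k(b-a)/2)], the integral of [|D|] over [[a, b]] is [2 (1 - q)^2 / k]; the bound is
    this times the mean of the chord. *)
Lemma exp_kernel_trapezoid_le (R : realType) (u du : R -> R) (a b k : R) :
  a < b -> 0 < k ->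
  {within `[a, b], continuous u} ->
  (forall x, x \in `]a, b[ -> is_derive x 1 u (du x)) ->
  (forall x, x \in `]a, b[ ->
    `|du x| <= ((b - x) * `|du a| + (x - a) * `|du b|) / (b - a)) ->
  `| (1 - expR (- k * (b - a))) * (u a + u b)
     - k * \int[@lebesgue_measure R]_(s in `[a, b])
             ((expR (- k * (b - s)) + expR (- k * (s - a))) * u s) |
  <= (`|du a| + `|du b|) * (1 - expR (- k * ((b - a) / 2))) ^+ 2 / k.
Proof.
move=> ab k0 cu hu hdu.
pose S s := expR (- k * (b - s)) + expR (- k * (s - a)).
pose D s := expR (- k * (b - s)) - expR (- k * (s - a)).
pose J x := \int[@lebesgue_measure R]_(s in `[a, x]) (S s * u s).
pose m : R := (a + b) / 2.
pose Phi := fun x : R => (D x * u x - k * J x : R).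
(* The chord is centred at [m]: [c] is its mean, [d] its slope. *)
pose c : R := (`|du a| + `|du b|) / 2.
pose d : R := (`|du b| - `|du a|) / (b - a).
pose g (x : R) : R := c + d * (x - m).
(* [G' = g D]: integrate by parts, using [(S / k)' = D], [(D / k)' = S], [g' = d]. *)
pose G := fun x : R => (g x * S x / k - d * D x / k ^+ 2 : R).
have dL (x : R) :
    is_derive x 1 (fun s => expR (- k * (b - s))) (k * expR (- k * (b - x))).
  have dl : is_derive x 1 (fun s => - k * (b - s)) k.
    apply: is_derive_eq; rewrite /GRing.scale /=; ring.
  have := @is_derive1_comp _ expR _ x _ _ (is_derive_expR _) dl.
  by rewrite mulrC.
have dR (x : R) :
    is_derive x 1 (fun s => expR (- k * (s - a))) (- k * expR (- k * (x - a))).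
  have dl : is_derive x 1 (fun s => - k * (s - a)) (- k).
    apply: is_derive_eq; rewrite /GRing.scale /=; ring.
  have := @is_derive1_comp _ expR _ x _ _ (is_derive_expR _) dl.
  by rewrite mulrC.
have dS (x : R) : is_derive x 1 S (k * D x).
  by apply: is_derive_eq; rewrite /D; ring.
have dD (x : R) : is_derive x 1 D (k * S x).
  by apply: is_derive_eq; rewrite /S; ring.
have dg (x : R) : is_derive x 1 g d.
  by apply: is_derive_eq; rewrite /GRing.scale /=; ring.
have dG (x : R) : is_derive x 1 G (g x * D x).
  apply: is_derive_eq; rewrite /GRing.scale /=.
  by field; rewrite gt_eqF.
have cS : continuous S.
  by move=> x; apply/differentiable_continuous/derivable1_diffP; have [] := dS x.
have cD : continuous D.
  by move=> x; apply/differentiable_continuous/derivable1_diffP; have [] := dD x.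
have cG : continuous G.
  by move=> x; apply/differentiable_continuous/derivable1_diffP; have [] := dG x.
have cSu : {within `[a, b], continuous (fun s => S s * u s)}.
  by move=> x; apply: cvgM; [exact: (continuous_subspaceT cS)|exact: cu].
have cPhi : {within `[a, b], continuous Phi}.
  apply: within_continuousB.
    by move=> x; apply: cvgM; [exact: (continuous_subspaceT cD)|exact: cu].
  (* Continuity of [J] up to the endpoints comes from integrability of [S u]. *)
  move=> x; apply: cvgMr; apply: parameterized_integral_continuous; first exact: ltW.
  by apply: continuous_compact_integrable => //; exact: segment_compact.
(* The term [k S u] from the product rule cancels against [k J']. *)
have dPhi x : x \in `]a, b[ -> is_derive x 1 Phi (D x * du x).
  move=> xab; have := hu _ xab => dux.
  have dJ := is_derive_Rintegral _ _ _ _ _ cSu xab.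
  rewrite -/(J) in dJ.
  apply: is_derive_eq; rewrite /GRing.scale /=; ring.
(* The values of [S] and [D] at [a], [m], [b] are all polynomials in [q]. *)
set q := expR (- k * ((b - a) / 2)).
have q2 : expR (- k * (b - a)) = q ^+ 2.
  by rewrite /q expr2 -expRD; congr expR; field.
have [Sa Sb] : S a = 1 + q ^+ 2 /\ S b = 1 + q ^+ 2.
  by rewrite /S !subrr !mulr0 !expR0 q2 addrC.
have [Da Db] : D a = q ^+ 2 - 1 /\ D b = 1 - q ^+ 2.
  by rewrite /D !subrr !mulr0 !expR0 q2.
have Sm : S m = 2 * q.
  have -> : S m = q + q by rewrite /S /q /m; congr (expR _ + expR _); field.
  ring.
have Dm : D m = 0.
  by apply/eqP; rewrite subr_eq0; apply/eqP; rewrite /m; congr expR; field.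
have D_ge0 x : m <= x -> 0 <= D x.
  move=> mx; rewrite subr_ge0 ler_expR ler_nM2l ?oppr_lt0 //; rewrite /m in mx; lra.
have D_le0 x : x <= m -> D x <= 0.
  move=> mx; rewrite subr_le0 ler_expR ler_nM2l ?oppr_lt0 //; rewrite /m in mx; lra.
have amb : a < m < b by rewrite /m; apply/andP; split; lra.
have /andP[am mb] := amb.
have hdg x : x \in `]a, b[ -> `|du x| <= g x.
  move=> xab; rewrite (le_trans (hdu _ xab)) // le_eqVlt; apply/orP; left; apply/eqP.
  rewrite /g /c /d /m; field; rewrite subr_eq0 gt_eqF //.
have Phi_right : `|Phi b - Phi m| <= G b - G m.
  have sub x : x \in `]m, b[ -> x \in `]a, b[.
    by rewrite !in_itv /= => /andP[? ->]; rewrite (lt_trans am).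
  have cPhim : {within `[m, b], continuous Phi}.
    apply: continuous_subspaceW cPhi => x /=; rewrite !in_itv /= => /andP[mx ->].
    by rewrite (le_trans (ltW am)).
  have cGm : {within `[m, b], continuous G} by exact: continuous_subspaceT.
  have leg x : x \in `]m, b[ -> `|D x * du x| <= g x * D x.
    move=> xmb; have Dx : 0 <= D x by apply: D_ge0; rewrite (itvP xmb).
    by rewrite normrM (ger0_norm Dx) mulrC ler_wpM2r // hdg // sub.
  exact: (ler_dist_derive R Phi G _ _ m b (ltW mb) cPhim cGm
    (fun x xmb => dPhi x (sub x xmb)) (fun x _ => dG x) leg).
(* Left of [m] the sign of [D] flips, so the comparison function is [- G]. *)
have Phi_left : `|Phi m - Phi a| <= - G m - - G a.
  have sub x : x \in `]a, m[ -> x \in `]a, b[.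
    by rewrite !in_itv /= => /andP[-> ?]; rewrite (lt_trans _ mb).
  have cPhim : {within `[a, m], continuous Phi}.
    apply: continuous_subspaceW cPhi => x /=; rewrite !in_itv /= => /andP[-> xm].
    by rewrite (le_trans xm (ltW mb)).
  have cGm : {within `[a, m], continuous (- G)}.
    by apply: continuous_subspaceT => x; apply: cvgN; exact: cG.
  have leg x : x \in `]a, m[ -> `|D x * du x| <= - (g x * D x).
    move=> xam; have Dx : D x <= 0 by apply: D_le0; rewrite (itvP xam).
    by rewrite normrM (ler0_norm Dx) mulrC -mulrN ler_wpM2r ?oppr_ge0 // hdg // sub.
  exact: (ler_dist_derive R Phi (- G) _ _ a m (ltW am) cPhim cGm
    (fun x xam => dPhi x (sub x xam)) (fun x _ => is_deriveN (dG x)) leg).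
have -> : (1 - expR (- k * (b - a))) * (u a + u b) - k * J b = Phi b - Phi a.
  rewrite /Phi Da Db q2.
  have -> : J a = 0 by rewrite /J set_itv1 Rintegral_set1.
  ring.
have -> : Phi b - Phi a = (Phi b - Phi m) + (Phi m - Phi a) by ring.
apply: (le_trans (ler_normD _ _)); apply: (le_trans (lerD Phi_right Phi_left)).
(* The bound [G a + G b - 2 G m] equals [2 c (1 - q)^2 / k]: the slope [d] drops out since
   [D a + D b = 0], [D m = 0] and [S a = S b]. *)
rewrite le_eqVlt; apply/orP; left; apply/eqP.
rewrite /G Sa Sb Sm Da Db Dm /g /c /d /m; field.
by rewrite gt_eqF //= subr_eq0 gt_eqF.
Qed.

Theorem theorem5p1 (R : realType) (I : set R) (u : R -> R) (a b alpha : R)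
    (hI : is_interval I)
    (hu : forall x, I x -> derivable_in I u x)
    (ha : I a) (hb : I b) (hab : a < b)
    (halpha0 : 0 < alpha) (halpha1 : alpha < 1)
    (hconv : convex_function (`[a, b]%classic : set R^o) (fun x => `|derive_in I u x|)) :
  let rho := (1 - alpha) / alpha * (b - a) in
  `| (u a + u b) / 2
     - (1 - alpha) / (2 * (1 - expR (- rho)))
       * (frac_int_left alpha a u b + frac_int_right alpha b u a) |
  <= (b - a) / (2 * rho) * tanh (rho / 4)
     * (`|derive_in I u a| + `|derive_in I u b|).
Proof.
set k := (1 - alpha) / alpha; move=> /=; set rho := k * (b - a).
have k0 : 0 < k by rewrite divr_gt0 // subr_gt0.
have abI : `[a, b] `<=` I.
  by move=> x /=; rewrite in_itv /=; exact: hI.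
have cu : {within `[a, b], continuous u}.
  by apply: continuous_subspaceW abI _; exact: derivable_in_continuous.
have du x : x \in `]a, b[ -> is_derive x 1 u (derive_in I u x).
  move=> xab; have nI : nbhs x I.
    apply: filterS (near_in_itvoo xab) => y yab; apply: abI => /=.
    exact: subset_itv_oo_cc yab.
  by apply: derivable_in_is_derive => //; exact: hu (nbhs_singleton nI).
have hdu x : x \in `]a, b[ -> `|derive_in I u x| <=
    ((b - x) * `|derive_in I u a| + (x - a) * `|derive_in I u b|) / (b - a).
  move=> xab.
  apply: (@convex_function_le_chord _ (fun x => `|derive_in I u x|)) => //.
  exact: subset_itv_oo_cc.
have := @exp_kernel_trapezoid_le _ _ _ _ _ _ hab k0 cu du hdu.
set J := Rintegral _ _ _.
have int_expR_mulu (f : R -> R) : continuous f ->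
    (@lebesgue_measure R).-integrable `[a, b] (EFin \o (fun s => expR (f s) * u s)).
  move=> cf; apply: continuous_compact_integrable; first exact: segment_compact.
  move=> x; apply: cvgM; last exact: cu.
  apply: continuous_subspaceT => y; apply: continuous_comp; first exact: cf.
  exact: continuous_expR.
(* At [b] and at [a] the two operators integrate over the same [[a, b]], and their kernels add up to
   the kernel of [J]. *)
have -> : frac_int_left alpha a u b + frac_int_right alpha b u a = alpha^-1 * J.
  rewrite /frac_int_left /frac_int_right -/k -mulrDr -RintegralD //.
  - by congr (_ * _); apply: eq_Rintegral => s _; rewrite mulrDl.
  - apply: int_expR_mulu => x; apply: cvgMr; apply: cvgB; [exact: cvg_cst|exact: cvg_id].
  - apply: int_expR_mulu => x; apply: cvgMr; apply: cvgB; [exact: cvg_id|exact: cvg_cst].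
set q := expR (- k * ((b - a) / 2)).
set A := _ + `|derive_in I u b|.
have q0 : 0 < q := expR_gt0 _.
have q1 : q < 1 by rewrite expR_lt1 mulNr oppr_lt0 mulr_gt0 // divr_gt0 // subr_gt0.
have q2 : expR (- k * (b - a)) = q ^+ 2.
  by rewrite /q expr2 -expRD; congr expR; field.
have -> : expR (- rho) = q ^+ 2 by rewrite -mulNr.
(* With [p = e^(-rho/4)], so that [q = p^2], multiply numerator and denominator of [tanh] by [p]. *)
have -> : tanh (rho / 4) = (1 - q) / (1 + q).
  set p := expR (- (rho / 4)).
  have p0 : 0 < p := expR_gt0 _.
  have -> : q = p ^+ 2.
    by rewrite /q expr2 -expRD /rho; congr expR; field.
  have pV : expR (rho / 4) = p^-1 by rewrite -expRN opprK.
  rewrite /tanh -/p pV; field.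
  by rewrite !gt_eqF // addr_gt0 // exprn_gt0.
rewrite q2 => J_bound.
have q2_lt1 : 0 < 1 - q ^+ 2 by rewrite subr_gt0 expr_lt1 // ltW.
set X := (X in `|X|) in J_bound.
(* The goal is [J_bound] divided by [2 (1 - q^2)]: on the left [(1 - alpha) / alpha = k], on the
   right [1 - q^2 = (1 - q)(1 + q)] and [(b - a) / rho = 1 / k]. *)
have -> : (u a + u b) / 2 - (1 - alpha) / (2 * (1 - q ^+ 2)) * (alpha^-1 * J) =
    X / (2 * (1 - q ^+ 2)).
  by rewrite /X /k; field; rewrite !gt_eqF.
have -> : (b - a) / (2 * rho) * ((1 - q) / (1 + q)) * A =
    A * (1 - q) ^+ 2 / k / (2 * (1 - q ^+ 2)).
  by rewrite /rho; field; rewrite !gt_eqF ?subr_gt0 ?addr_gt0 // -subr_gt0.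
have c_gt0 : 0 < 2 * (1 - q ^+ 2) by rewrite mulr_gt0.
by rewrite normrM normfV (gtr0_norm c_gt0) ler_pM2r // invr_gt0.
Qed.
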